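(* Let $F=f$ satisfy the assumptions in the context. If in the smooth ACPP algorithm (described in the context) we set $s=0$ and choose the sampling probabilities $p_i\propto\sqrt{\tilde L_i}$, then the total number of block gradient computations needed to guarantee $\mathbb{E}\|\nabla F(x^{\hat k})\|^2\le\varepsilon$ is bounded by $$N_{\varepsilon}=\mathcal{O}\left(\Bigl(\sum_{i=1}^{m}\sqrt{L_{i}}\Bigr)\sqrt{\mu}\,\log\left(\frac{L}{\mu}\right)\frac{\mu\|x^{0}-x^{*}\|^{2}}{\varepsilon}\right).$$
   Context: Notation. $[m]=\{1,\dots,m\}$. $d=\sum_{i=1}^m d_i$, and $U_i\in\mathbb{R}^{d\times d_i}$ are such that $[U_1,\dots,U_m]=I_d$. For $x\in\mathbb{R}^d$, $x_i=U_i^Tx\in\mathbb{R}^{d_i}$ is the $i$-th block; $\nabla_i f(x)=U_i^T\nabla f(x)$. $\|\cdot\|_i$ is the Euclidean norm on $\mathbb{R}^{d_i}$, $\|\cdot\|$ the Euclidean norm on $\mathbb{R}^d$. Assumptions. The problem is $\min_{x\in\mathbb{R}^d}F(x)=f(x)$, where: (i) $f:\mathbb{R}^d\to\mathbb{R}$ is continuously differentiable and block-wise Lipschitz smooth with constants $L_1,\dots,L_m>0$: $\|\nabla_i f(x)-\nabla_i f(x+U_it)\|_i\le L_i\|t\|_i$ for all $x\in\mathbb{R}^d$, $t\in\mathbb{R}^{d_i}$, $i\in[m]$; and $\|\nabla f(x)-\nabla f(y)\|\le L\|x-y\|$ for all $x,y$, with $L>0$; (ii) $f$ is $\mu$-weakly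 convex, $\mu>0$: $f(x)\ge f(y)+\langle\nabla f(y),x-y\rangle-\frac{\mu}{2}\|x-y\|^2$ for all $x,y$; (iii) the problem is ill-conditioned in the sense that $\mu\ll L_i$ for all $i\in[m]$; (iv) every lower level set $\{x:F(x)\le r\}$, $r\in\mathbb{R}$, is bounded; (v) there is $x^*$ with $F(x^* )=\min_xF(x)>-\infty$. Constants: $\tilde L_i=L_i+2\mu$. Smooth ACPP algorithm with $s=0$. Input $x^0,\mu,t$. For $k=0,1,\dots,K$: let $F_k(x)=F(x)+\mu\|x-x^k\|^2$, and let $x^{k+1}$ be the output of $t$ iterations of the ACD method below applied to $F_k$, started at $x^k$, with block constants $\tilde L_i$ and strong convexity parameter $\mu$ (with respect to $\|\cdot\|$), using samples independent of the past. Finally choose $\hat k$ uniformly at random from $\{2,3,\dots,K+1\}$, independently of everything else, and output $x^{\hat k}$. The expectation is over all randomness. The number of block gradient computations is counted as $t(K+1)$, with $t$ and $K$ chosen suitably for the target accuracy $\varepsilon>0$. ACD method with $s=0$ (applied to a smooth convex function $q$ with block constants $\tilde L_i$, strong convexity parameter $\mu$, starting point $w^0$, $t$ iterations). Let $T=\sum_i\sqrt{\tilde L_i}$, $p_i=\sqrt{\tilde L_i}/T$, $\alpha=\frac{\sqrt{\mu}}{\sqrt{\mu}+T}$, $\beta=\sqrt{\mu}\,T$, $\gamma=\mu$, $z^0=w^0$. For $j=0,\dots,t-1$: set $y^j=(1-\alpha)w^j+\alpha z^j$; sample $i_j\in[m]$ (independently) with $\Pr(i_j=i)=p_i$; set $$z^{j+1}=\operatorname{argmin}_x\Bigl\{\langle\nabla_{i_j}q(y^j),x_{i_j}\rangle+\tfrac{p_{i_j}\gamma}{2}\|x-y^j\|^2+\tfrac{p_{i_j}\beta}{2}\|x-z^j\|^2\Bigr\},\qquad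 \bar w^{j+1}=y^j+\tfrac{\alpha}{p_{i_j}}U_{i_j}(z^{j+1}_{i_j}-z^j_{i_j});$$ then either (Option I) $w^{j+1}_{i_j}=\operatorname{argmin}_{x\in\mathbb{R}^{d_{i_j}}}\{\langle\nabla_{i_j}q(\bar w^{j+1}),x\rangle+\frac{\tilde L_{i_j}}{2}\|x-\bar w^{j+1}_{i_j}\|_{i_j}^2\}$ and $w^{j+1}_l=\bar w^{j+1}_l$ for $l\ne i_j$, or (Option II) $w^{j+1}=\bar w^{j+1}$. The output is $w^t$.
   Formalization: The bound is stated for ε ≤ μ²‖x⁰−x*‖² (any ε>0 if x⁰=x* ); μ≪L_i is read as κμ ≤ L_i for an arbitrary fixed κ>1, also κμ ≤ L is assumed, and the O-constant depends only on κ. *)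

(* Defs.v *)
From mathcomp Require Import all_boot all_order all_algebra.
From mathcomp Require Import all_classical all_reals all_analysis.
Import Order.TTheory GRing.Theory Num.Theory.
Import numFieldNormedType.Exports.

Set Implicit Arguments.
Unset Strict Implicit.
Unset Printing Implicit Defensive.

Local Open Scope classical_set_scope.
Local Open Scope ring_scope.

(* Vectors of R^n are columns. The norm `|x| that the library puts on matrices
   is the sup norm, hence the separate Euclidean norm [enorm]; the topology
   (differentiability, continuity, boundedness) is the same for both. *)

Definition dotp (R : realType) (n : nat) (x y : 'cV[R]_n) : R :=
  \sum_(i < n) x i 0 * y i 0.

Definition enorm (R : realType) (n : nat) (x : 'cV[R]_n) : R :=
  Num.sqrt (dotp x x).

Definition grad (R : realType) (n : nat) (f : 'cV[R]_n -> R) (x : 'cV[R]_n) :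
    'cV[R]_n :=
  \col_(j < n) 'D_(delta_mx j 0) f x.

Definition continuously_differentiable (R : realType) (n : nat)
    (f : 'cV[R]_n -> R) : Prop :=
  (forall x, differentiable f x) /\ continuous (grad f).

(* A minimizer of g; the value is 0 when g has none. All functions minimized
   below are strongly convex quadratics, so their minimizer exists and is
   unique. *)
Definition argmin (R : realType) (n : nat) (g : 'cV[R]_n -> R) : 'cV[R]_n :=
  xget 0 [set x | forall y, g x <= g y].

Definition bdim (m : nat) (d_ : 'I_m -> nat) : nat := (\sum_(i < m) d_ i)%N.

Definition Ublk (R : realType) (m : nat) (d_ : 'I_m -> nat) (i : 'I_m) :
    'M[R]_(bdim d_, d_ i) :=
  submxrow (1%:M : 'M[R]_(bdim d_)) i.

Lemma mxrow_Ublk (R : realType) (m : nat) (d_ : 'I_m -> nat) :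
  \mxrow_(i < m) Ublk R d_ i = 1%:M.
Proof. exact: submxrowK. Qed.

Definition blk (R : realType) (m : nat) (d_ : 'I_m -> nat) (i : 'I_m)
    (x : 'cV[R]_(bdim d_)) : 'cV[R]_(d_ i) :=
  (Ublk R d_ i)^T *m x.

Definition block_smooth (R : realType) (m : nat) (d_ : 'I_m -> nat)
    (L_ : 'I_m -> R) (f : 'cV[R]_(bdim d_) -> R) : Prop :=
  forall (i : 'I_m) (x : 'cV[R]_(bdim d_)) (s : 'cV[R]_(d_ i)),
    enorm (blk i (grad f x) - blk i (grad f (x + Ublk R d_ i *m s)))
      <= L_ i * enorm s.

Definition smooth (R : realType) (n : nat) (L : R) (f : 'cV[R]_n -> R) : Prop :=
  forall x y, enorm (grad f x - grad f y) <= L * enorm (x - y).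

Definition weakly_convex (R : realType) (n : nat) (mu : R)
    (f : 'cV[R]_n -> R) : Prop :=
  forall x y,
    f y + dotp (grad f y) (x - y) - mu / 2 * enorm (x - y) ^+ 2 <= f x.

Definition bounded_level_sets (R : realType) (n : nat) (f : 'cV[R]_n -> R) :
    Prop :=
  forall r : R, bounded_set [set x | f x <= r].

Definition sampT (R : realType) (m : nat) (Lt : 'I_m -> R) : R :=
  \sum_(i < m) Num.sqrt (Lt i).

Definition sampp (R : realType) (m : nat) (Lt : 'I_m -> R) (i : 'I_m) : R :=
  Num.sqrt (Lt i) / sampT Lt.

Inductive acd_option := OptionI | OptionII.

(* One iteration (w^j, z^j) |-> (w^(j+1), z^(j+1)) of ACD with sampled block i.
   In Option I, wbar + U_i (v - wbar_i) is wbar with its i-th block replaced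
   by v. *)
Definition acd_step (R : realType) (m : nat) (d_ : 'I_m -> nat)
    (opt : acd_option) (Lt : 'I_m -> R) (mu : R) (q : 'cV[R]_(bdim d_) -> R)
    (wz : 'cV[R]_(bdim d_) * 'cV[R]_(bdim d_)) (i : 'I_m) :
    'cV[R]_(bdim d_) * 'cV[R]_(bdim d_) :=
  let: (w, z) := wz in
  let T := sampT Lt in
  let p := sampp Lt i in
  let alpha := Num.sqrt mu / (Num.sqrt mu + T) in
  let beta := Num.sqrt mu * T in
  let gamma := mu in
  let y := (1 - alpha) *: w + alpha *: z in
  let z' := argmin (fun x : 'cV[R]_(bdim d_) =>
    dotp (blk i (grad q y)) (blk i x)
    + p * gamma / 2 * enorm (x - y) ^+ 2
    + p * beta / 2 * enorm (x - z) ^+ 2) in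
  let wbar := y + (alpha / p) *: (Ublk R d_ i *m (blk i z' - blk i z)) in
  let w' :=
    match opt with
    | OptionI =>
        let v := argmin (fun x : 'cV[R]_(d_ i) =>
          dotp (blk i (grad q wbar)) x
          + Lt i / 2 * enorm (x - blk i wbar) ^+ 2) in
        wbar + Ublk R d_ i *m (v - blk i wbar)
    | OptionII => wbar
    end in
  (w', z').

Definition acd (R : realType) (m : nat) (d_ : 'I_m -> nat)
    (opt : acd_option) (Lt : 'I_m -> R) (mu : R) (q : 'cV[R]_(bdim d_) -> R)
    (w0 : 'cV[R]_(bdim d_)) (s : seq 'I_m) : 'cV[R]_(bdim d_) :=
  (foldl (acd_step opt Lt mu q) (w0, w0) s).1.

(* An outcome of all the randomness of a run: the block sampled at inner
   iteration j < t of outer iteration k <= K, and an index l < K encoding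
   khat = l + 2 in {2, ..., K + 1}. *)
Definition acpp_outcome (m t K : nat) : finType :=
  (K.+1.-tuple (t.-tuple 'I_m) * 'I_K)%type.

(* The joint law: independent blocks drawn with probabilities p_i, and an
   independent uniform khat. *)
Definition acpp_prob (R : realType) (m t K : nat) (Lt : 'I_m -> R)
    (om : acpp_outcome m t K) : R :=
  (\prod_(k < K.+1) \prod_(j < t) sampp Lt (tnth (tnth om.1 k) j)) * K%:R^-1.

Definition acpp_expectation (R : realType) (m t K : nat) (Lt : 'I_m -> R)
    (X : acpp_outcome m t K -> R) : R :=
  \sum_(om : acpp_outcome m t K) acpp_prob Lt om * X om.

Definition acpp_Lt (R : realType) (m : nat) (L_ : 'I_m -> R) (mu : R)
    (i : 'I_m) : R :=
  L_ i + 2 * mu.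

(* The iterate x^k; the k-th inner run uses the k-th tuple of samples. *)
Definition acpp_iter (R : realType) (m : nat) (d_ : 'I_m -> nat) (t K : nat)
    (opt : acd_option) (L_ : 'I_m -> R) (mu : R) (F : 'cV[R]_(bdim d_) -> R)
    (x0 : 'cV[R]_(bdim d_)) (om : acpp_outcome m t K) (k : nat) :
    'cV[R]_(bdim d_) :=
  foldl (fun (xk : 'cV[R]_(bdim d_)) (s : t.-tuple 'I_m) =>
           acd opt (acpp_Lt L_ mu) mu
             (fun x => F x + mu * enorm (x - xk) ^+ 2) xk s)
        x0 (take k om.1).

Definition acpp_output (R : realType) (m : nat) (d_ : 'I_m -> nat) (t K : nat)
    (opt : acd_option) (L_ : 'I_m -> R) (mu : R) (F : 'cV[R]_(bdim d_) -> R)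
    (x0 : 'cV[R]_(bdim d_)) (om : acpp_outcome m t K) : 'cV[R]_(bdim d_) :=
  acpp_iter opt L_ mu F x0 om (om.2 + 2)%N.

(* Main.v *)
Require Import Defs.
From mathcomp Require Import all_boot all_order all_algebra.
From mathcomp Require Import all_classical all_reals all_analysis.
From mathcomp Require Import ring lra.
Import Order.TTheory GRing.Theory Num.Theory.
Import numFieldNormedType.Exports.

Set Implicit Arguments.
Unset Strict Implicit.
Unset Printing Implicit Defensive.

Local Open Scope classical_set_scope.
Local Open Scope ring_scope.

(** The proximal objective F_k(x) = F(x) + mu ||x - x^k||^2 is strongly convex
    with modulus mu, since F is mu-weakly convex, and its blocks are smooth with
    constants L_i + 2 mu.

    Inner loop. For any reference point u the potential
    q(w) - q(u) + mu / 2 ||u - z||^2 of the accelerated coordinate method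
    contracts in mean by the factor 1 - alpha, alpha = sqrt mu / (sqrt mu + T),
    at each step ([acd_step_contract]). Taking for u a near-minimizer of q
    and bounding its distance to the starting point by strong convexity gives
    the mean contraction of the gap to inf q by 3 (1 - alpha)^t
    ([mean_acd_gap]). Hence about (T / sqrt mu) ln (L / mu) inner steps make the
    factor at most delta = mu / (L + 2 mu).

    Outer loop. Let l = inf F_k and x = x^(k+1). As
    grad F(x) = grad F_k(x) - 2 mu (x - x^k), and as |grad F_k(x)|^2 is at most
    2 (L + 2 mu) (F_k(x) - l),
      |grad F(x)|^2 + 8 mu F(x) <= (4 (L + 2 mu) + 8 mu) (F_k(x) - l) + 8 mu l.
    The inner loop bounds the mean of F_k(x) - l by delta (F(x^k) - l), so the
    right side has mean at most 8 mu F(x^k): each outer iteration pays for the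
    squared gradient at its output with a decrease of 8 mu F
    ([mean_outer_decrease]). Telescoping from x^1 bounds the mean of the sum of
    the squared gradients at x^2, ..., x^(K+1) by 8 mu times the mean gap
    F(x^1) - F(xstar). That gap is at most 2 mu ||x^0 - xstar||^2
    ([mean_first_gap]), because the first proximal value is compared with
    F_0(xstar) and the contribution of the possibly large F(x^0) - F(xstar) is
    multiplied by delta.
    Averaging over khat gives 16 mu^2 ||x^0 - xstar||^2 / K
    ([mean_run_sq_grad]), and K of order mu^2 ||x^0 - xstar||^2 / eps suffices.

    Since L / mu and all L_i / mu are at least kappa > 1, the additive constants
    in the logarithm and in T and the roundings to integers are absorbed in a
    factor that depends on kappa only ([iteration_budget]). When x^0 = xstar no
    inner step is needed. *)

(** * Euclidean geometry of columns and blocks *)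

Lemma dotpC (R : realType) n (x y : 'cV[R]_n) : dotp x y = dotp y x.
Proof. by apply: eq_bigr => i _; rewrite mulrC. Qed.

Lemma dotpDl (R : realType) n (x y z : 'cV[R]_n) :
  dotp (x + y) z = dotp x z + dotp y z.
Proof.
by rewrite /dotp -big_split; apply: eq_bigr => i _; rewrite mxE mulrDl.
Qed.

Lemma dotpZl (R : realType) n (a : R) (x z : 'cV[R]_n) :
  dotp (a *: x) z = a * dotp x z.
Proof.
by rewrite /dotp mulr_sumr; apply: eq_bigr => i _; rewrite mxE mulrA.
Qed.

Lemma dotpNl (R : realType) n (x z : 'cV[R]_n) : dotp (- x) z = - dotp x z.
Proof. by rewrite -scaleN1r dotpZl mulN1r. Qed.

Lemma dotpDr (R : realType) n (x y z : 'cV[R]_n) :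
  dotp x (y + z) = dotp x y + dotp x z.
Proof. by rewrite dotpC dotpDl !(dotpC x). Qed.

Lemma dotpZr (R : realType) n (a : R) (x z : 'cV[R]_n) :
  dotp x (a *: z) = a * dotp x z.
Proof. by rewrite dotpC dotpZl dotpC. Qed.

Lemma dotpNr (R : realType) n (x z : 'cV[R]_n) : dotp x (- z) = - dotp x z.
Proof. by rewrite dotpC dotpNl dotpC. Qed.

Definition dotpE := (dotpDl, dotpNl, dotpZl, dotpDr, dotpNr, dotpZr).

Lemma dotp0l (R : realType) n (x : 'cV[R]_n) : dotp 0 x = 0.
Proof. by rewrite -(scale0r 0) dotpZl mul0r. Qed.

Lemma dotp_ge0 (R : realType) n (x : 'cV[R]_n) : 0 <= dotp x x.
Proof. by apply: sumr_ge0 => i _; rewrite -expr2 sqr_ge0. Qed.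

Lemma enorm_sq (R : realType) n (x : 'cV[R]_n) : enorm x ^+ 2 = dotp x x.
Proof. by rewrite sqr_sqrtr // dotp_ge0. Qed.

Lemma enorm_ge0 (R : realType) n (x : 'cV[R]_n) : 0 <= enorm x.
Proof. exact: sqrtr_ge0. Qed.

Lemma dotp_eq0 (R : realType) n (x : 'cV[R]_n) : (dotp x x <= 0) -> x = 0.
Proof.
move=> h; have /eqP : dotp x x = 0 by apply/eqP; rewrite eq_le h dotp_ge0.
rewrite psumr_eq0 => [/allP H|i _]; last by rewrite -expr2 sqr_ge0.
apply/matrixP => i j; rewrite (ord1 j) mxE; apply/eqP.
by have := H i (mem_index_enum _); rewrite -expr2 sqrf_eq0.
Qed.

Lemma dotp_sqD (R : realType) n (x y : 'cV[R]_n) :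
  dotp (x + y) (x + y) = dotp x x + 2 * dotp x y + dotp y y.
Proof. by rewrite !dotpE (dotpC y x); ring. Qed.

(** The form of the Cauchy-Schwarz inequality that gradient Lipschitz bounds
    need; it is the expansion of the square of a - c b. *)
Lemma dotp_le_of_enorm (R : realType) n (a b : 'cV[R]_n) (c : R) :
  0 < c -> enorm a <= c * enorm b -> dotp a b <= c * dotp b b.
Proof.
move=> c0 h.
have h2 : dotp a a <= c ^+ 2 * dotp b b.
  by rewrite -!enorm_sq -exprMn ler_sqr // nnegrE ?mulr_ge0 ?enorm_ge0 // ltW.
have := dotp_ge0 (a - c *: b); rewrite !dotpE (dotpC b a) => h3.
rewrite -(ler_pM2l c0); nra.
Qed.

Lemma dotp_adjoint (R : realType) k n (A : 'M[R]_(n, k)) (x : 'cV[R]_k)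
  (y : 'cV[R]_n) : dotp (A *m x) y = dotp x (A^T *m y).
Proof.
rewrite /dotp.
under eq_bigr => i _ do rewrite mxE mulr_suml.
rewrite exchange_big; apply: eq_bigr => j _ /=.
by rewrite mxE mulr_sumr; apply: eq_bigr => i _; rewrite mxE; ring.
Qed.

Lemma dotp_Ublk (R : realType) m (d_ : 'I_m -> nat) i (s : 'cV[R]_(d_ i))
  (x : 'cV[R]_(bdim d_)) : dotp (Ublk R d_ i *m s) x = dotp s (blk i x).
Proof. exact: dotp_adjoint. Qed.

Lemma blk_Ublk (R : realType) m (d_ : 'I_m -> nat) i (s : 'cV[R]_(d_ i)) :
  blk i (Ublk R d_ i *m s) = s.
Proof.
rewrite /blk mulmxA; suff -> : (Ublk R d_ i)^T *m Ublk R d_ i = 1%:M.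
  by rewrite mul1mx.
have : \mxblock_(i, j) ((Ublk R d_ i)^T *m Ublk R d_ j) = 1%:M.
  by rewrite -mul_mxcol_mxrow -tr_mxrow mxrow_Ublk trmx1 mulmx1.
move=> /(congr1 (fun A => submxblock A i i)); rewrite mxblockK => ->.
apply/matrixP => a b; rewrite !mxE; congr (_%:R); congr nat_of_bool.
exact: (inj_eq (inc_inj (@tagnat.le_Rank _ _ i))).
Qed.

Lemma blkB (R : realType) m (d_ : 'I_m -> nat) i (x y : 'cV[R]_(bdim d_)) :
  blk i (x - y) = blk i x - blk i y.
Proof. exact: mulmxBr. Qed.

Lemma sum_dotp_blk (R : realType) m (d_ : 'I_m -> nat)
  (x y : 'cV[R]_(bdim d_)) : \sum_i dotp (blk i x) (blk i y) = dotp x y.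
Proof.
under eq_bigr => i _ do rewrite -dotp_Ublk.
have {2}-> : x = \sum_i Ublk R d_ i *m blk i x.
  under eq_bigr => i _ do rewrite /blk mulmxA.
  rewrite -mulmx_suml -mul_mxrow_mxcol -tr_mxrow mxrow_Ublk trmx1 mulmx1.
  by rewrite mul1mx.
by rewrite (big_morph (fun z => dotp z y) (fun a b => dotpDl a b y)
                      (dotp0l y)).
Qed.

Lemma dotp_blk_le (R : realType) m (d_ : 'I_m -> nat) i
  (x : 'cV[R]_(bdim d_)) : dotp (blk i x) (blk i x) <= dotp x x.
Proof.
rewrite -(sum_dotp_blk x x) (bigD1 i) //= lerDl.
by apply: sumr_ge0 => j _; exact: dotp_ge0.
Qed.

(** * Minimizers of quadratics *)

Lemma argmin_unique (R : realType) n (g : 'cV[R]_n -> R) x0 (c : R) :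
  0 < c -> (forall e, g (x0 + e) = g x0 + c * dotp e e) -> argmin g = x0.
Proof.
move=> c0 hg.
have hmin y : g x0 <= g y.
  by rewrite -(subrKC x0 y) hg lerDl mulr_ge0 ?dotp_ge0 // ltW.
have : [set x | forall y, g x <= g y] (argmin g).
  by apply: (@xgetI _ _ _ x0).
move=> /(_ x0) /=; rewrite -{1}(subrKC x0 (argmin g)) hg gerDl.
by rewrite pmulr_rle0 // => /dotp_eq0 /subr0_eq.
Qed.

(** A quadratic is its minimum plus its second-order term at the minimizer,
    which is the point where v + a (x - y) + b (x - z) vanishes. *)
Lemma argmin_three_point (R : realType) n (phi : 'cV[R]_n -> R)
  (v y z : 'cV[R]_n) (a b : R) :
  (forall x, phi x = dotp v x + a / 2 * dotp (x - y) (x - y)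
                     + b / 2 * dotp (x - z) (x - z)) ->
  0 < a + b ->
  forall x, phi x = phi (argmin phi)
    + (a + b) / 2 * dotp (x - argmin phi) (x - argmin phi).
Proof.
move=> phiE ab0.
set x0 := (a + b)^-1 *: (a *: y + b *: z - v).
have crit : v + a *: (x0 - y) + b *: (x0 - z) = 0.
  apply/matrixP => i j; rewrite /x0 !mxE; field; exact: lt0r_neq0.
have h e : phi (x0 + e) = phi x0 + (a + b) / 2 * dotp e e.
  have := congr1 (fun d => dotp d e) crit; rewrite !dotpDl !dotpZl dotp0l => ce.
  rewrite !phiE [x0 + e - y]addrAC [x0 + e - z]addrAC.
  rewrite (dotp_sqD (x0 - y)) (dotp_sqD (x0 - z)) (dotpDr v).
  by lra.
rewrite (argmin_unique _ h) ?divr_gt0 // => x.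
by rewrite -h subrKC.
Qed.

(** The correction of Option I, a block gradient step, does not increase the
    upper model of the objective; this is the change of that model. *)
Lemma argmin_step_le0 (R : realType) n (v c : 'cV[R]_n) (l : R)
  (x := argmin (fun x => dotp v x + l / 2 * enorm (x - c) ^+ 2)) :
  0 < l -> dotp v (x - c) + l / 2 * dotp (x - c) (x - c) <= 0.
Proof.
rewrite /x; set phi := fun x => _; move=> l0.
have phiE z : phi z = dotp v z + l / 2 * dotp (z - c) (z - c)
                      + 0 / 2 * dotp (z - 0) (z - 0).
  by rewrite /phi enorm_sq mul0r mul0r addr0.
have := argmin_three_point phiE; rewrite addr0 => /(_ l0 c).
have : 0 <= l / 2 * dotp (c - argmin phi) (c - argmin phi).
  by rewrite mulr_ge0 ?dotp_ge0 // divr_ge0 // ltW.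
set y := argmin phi; rewrite !phiE subrr dotp0l (dotpDr v) dotpNr; lra.
Qed.

(** * Quadratic upper bounds from Lipschitz gradients *)

Lemma derive_grad (R : realType) n (f : 'cV[R]_n -> R) x v :
  differentiable f x -> 'D_v f x = dotp (grad f x) v.
Proof.
move=> df; rewrite deriveE //.
have {1}-> : v = \sum_(j < n) v j 0 *: delta_mx j 0.
  rewrite {1}(matrix_sum_delta v); apply: eq_bigr => j _.
  by rewrite big_ord1.
rewrite linear_sum; apply: eq_bigr => j _.
by rewrite linearZ /= mxE deriveE // mulrC.
Qed.

Lemma is_derive_line (R : realType) n (f : 'cV[R]_n -> R) x v (t : R) :
  differentiable f (x + t *: v) ->
  is_derive t (1 : R) (fun u : R => f (x + u *: v))
    (dotp (grad f (x + t *: v)) v).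
Proof.
move=> df; have dv := @diff_derivable _ _ _ f _ v df.
have e : (fun h : R => h^-1 *: (((fun u : R => f (x + u *: v)) \o shift t)
             (h *: (1 : R)) - f (x + t *: v))) =
         (fun h => h^-1 *: ((f \o shift (x + t *: v)) (h *: v)
             - f (x + t *: v))).
  apply/funext => h /=; congr (_ *: (f _ - _)).
  by rewrite -[_ *: 1]/(_ * 1) mulr1 scalerDl addrCA.
split; first by rewrite /derivable e.
by rewrite /derive e -derive_grad.
Qed.

(** Mean value theorem for the difference between f along the segment and the
    parabola with second derivative c. *)
Lemma descent_segment (R : realType) n (f : 'cV[R]_n -> R) x v (c : R) :
  (forall y, differentiable f y) ->
  (forall t : R, 0 < t -> dotp (grad f (x + t *: v) - grad f x) v <= c * t) ->
  f (x + v) <= f x + dotp (grad f x) v + c / 2.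
Proof.
move=> df hc.
pose g := (fun u : R => f (x + u *: v)) - (fun u : R => c / 2 * u ^+ 2).
have dg (t : R) : is_derive t (1 : R) g (dotp (grad f (x + t *: v)) v - c * t).
  apply: is_deriveB; first exact: is_derive_line.
  by apply: is_derive_eq; rewrite /GRing.scale /=; field.
have [s s01 gs] : exists2 t, t \in `]0, 1[%R &
    g 1 - g 0 = (dotp (grad f (x + t *: v)) v - c * t) * (1 - 0).
  apply: MVT => //; apply: derivable_within_continuous => t _.
  exact: ex_derive.
have s0 : 0 < s by move: s01; rewrite in_itv => /andP[].
move: gs; rewrite /g !fctE scale1r scale0r addr0 => gs.
by move: (hc s s0); rewrite dotpDl dotpNl; lra.
Qed.

Lemma smooth_descent (R : realType) n (f : 'cV[R]_n -> R) (L : R) x v :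
  0 < L -> (forall y, differentiable f y) -> smooth L f ->
  f (x + v) <= f x + dotp (grad f x) v + L / 2 * dotp v v.
Proof.
move=> L0 df sf; rewrite [L / 2 * _]mulrAC; apply: descent_segment => // t t0.
rewrite -(ler_pM2l t0) -dotpZr.
have -> : t * (L * dotp v v * t) = L * dotp (t *: v) (t *: v).
  by rewrite !dotpE; ring.
apply: dotp_le_of_enorm => //.
by have := sf (x + t *: v) x; rewrite [x + _ - x]addrAC subrr add0r.
Qed.

Lemma block_descent (R : realType) m (d_ : 'I_m -> nat) (L_ : 'I_m -> R)
  (f : 'cV[R]_(bdim d_) -> R) i x (s : 'cV[R]_(d_ i)) :
  0 < L_ i -> (forall y, differentiable f y) -> block_smooth L_ f ->
  f (x + Ublk R d_ i *m s) <=
    f x + dotp (blk i (grad f x)) s + L_ i / 2 * dotp s s.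
Proof.
move=> L0 df sf.
have -> : dotp (blk i (grad f x)) s = dotp (grad f x) (Ublk R d_ i *m s).
  by rewrite dotpC -dotp_Ublk dotpC.
rewrite [L_ i / 2 * _]mulrAC; apply: descent_segment => // t t0.
rewrite dotpC dotp_Ublk dotpC -(ler_pM2l t0) -dotpZr.
have -> : t * (L_ i * dotp s s * t) = L_ i * dotp (t *: s) (t *: s).
  by rewrite !dotpE; ring.
apply: dotp_le_of_enorm => //.
have := sf i x (t *: s); rewrite -scalemxAr => h.
rewrite blkB; move: h; rewrite /enorm -[blk i _ - blk i _]opprB dotpNl dotpNr.
by rewrite opprK.
Qed.

(** * The proximal objective *)

(** The function minimized approximately by one outer iteration started
    at c. *)
Definition prox_obj (R : realType) n (mu : R) (F : 'cV[R]_n -> R)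
  (c x : 'cV[R]_n) : R := F x + mu * enorm (x - c) ^+ 2.

Lemma is_derive_sqdist (R : realType) n (mu : R) (c x v : 'cV[R]_n) :
  is_derive x v (fun y : 'cV[R]_n => mu * enorm (y - c) ^+ 2)
    (2 * mu * dotp (x - c) v).
Proof.
set f := fun y : 'cV[R]_n => _.
have lim : (fun h : R => h^-1 *: ((f \o shift x) (h *: v) - f x)) @ 0^'
           --> 2 * mu * dotp (x - c) v.
  have e : forall h : R, h \in [set h | h != 0] ->
      2 * mu * dotp (x - c) v + h * (mu * dotp v v) =
      h^-1 *: ((f \o shift x) (h *: v) - f x).
    move=> h; rewrite inE /= => h0.
    rewrite /f /= !enorm_sq -addrA (addrC (h *: v)) (dotp_sqD (x - c)).
    rewrite !(dotpZl, dotpZr).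
    by rewrite -[h^-1 *: _]/(h^-1 * _); field.
  apply: cvg_trans; first apply: near_eq_cvg.
    near=> h; apply: e; rewrite inE; near: h; exact: nbhs_dnbhs_neq.
  have H : (2 * mu * dotp (x - c) v + h * (mu * dotp v v)) @[h --> (0 : R)^']
           --> 2 * mu * dotp (x - c) v + 0 * (mu * dotp v v).
    apply: cvg_within_filter; apply: cvgD; first exact: cvg_cst.
    by apply: cvgMl; exact: cvg_id.
  by rewrite mul0r addr0 in H.
split; first by apply/cvg_ex; eexists; exact: lim.
by apply: cvg_lim lim; exact: Rhausdorff.
Unshelve. all: by end_near.
Qed.

Lemma grad_prox_obj (R : realType) n (mu : R) (F : 'cV[R]_n -> R) c x :
  differentiable F x ->
  grad (prox_obj mu F c) x = grad F x + (2 * mu) *: (x - c).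
Proof.
move=> dF; apply/matrixP => j k; rewrite (ord1 k) !mxE.
have dq := is_derive_sqdist mu c x (delta_mx j 0).
rewrite /prox_obj (@deriveD _ _ _ F); last exact: ex_derive.
  rewrite (@derive_val _ _ _ _ _ _ _ dq) /dotp (bigD1 j) //=.
  rewrite !mxE !eqxx mulr1 big1 ?addr0 //.
  by move=> i /negPf ij; rewrite [X in _ * X]mxE ij mulr0.
exact: diff_derivable.
Qed.

Lemma prox_obj_shift (R : realType) n (mu : R) (F : 'cV[R]_n -> R) c x v :
  prox_obj mu F c (x + v) =
    F (x + v) + mu * (dotp (x - c) (x - c) + 2 * dotp (x - c) v + dotp v v).
Proof. by rewrite /prox_obj enorm_sq [x + v - c]addrAC (dotp_sqD (x - c)). Qed.

Lemma prox_obj_descent (R : realType) n (mu L : R) (F : 'cV[R]_n -> R) c x v :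
  0 < L -> (forall y, differentiable F y) -> smooth L F ->
  prox_obj mu F c (x + v) <= prox_obj mu F c x
    + dotp (grad (prox_obj mu F c) x) v + (L + 2 * mu) / 2 * dotp v v.
Proof.
move=> L0 dF sF; have := smooth_descent x v L0 dF sF.
rewrite prox_obj_shift grad_prox_obj // /prox_obj enorm_sq.
rewrite (dotpDl (grad F _)) dotpZl; lra.
Qed.

Lemma prox_obj_block_descent (R : realType) m (d_ : 'I_m -> nat)
  (L_ : 'I_m -> R) (mu : R) (F : 'cV[R]_(bdim d_) -> R) c i x
  (s : 'cV[R]_(d_ i)) :
  0 < L_ i -> (forall y, differentiable F y) -> block_smooth L_ F ->
  prox_obj mu F c (x + Ublk R d_ i *m s) <= prox_obj mu F c x
    + dotp (blk i (grad (prox_obj mu F c) x)) s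
    + acpp_Lt L_ mu i / 2 * dotp s s.
Proof.
move=> L0 dF sF; have := block_descent x s L0 dF sF.
rewrite prox_obj_shift grad_prox_obj // /prox_obj enorm_sq.
rewrite ![dotp (blk i _) s]dotpC -!dotp_Ublk.
rewrite (dotpDr _ (grad F x)) dotpZr (dotp_Ublk s (_ *m _)) blk_Ublk.
rewrite (dotpC (x - c) (_ *m _)) /acpp_Lt; lra.
Qed.

(** The term mu ||x - c||^2 has convexity modulus 2 mu, which leaves mu after
    the loss of mu from weak convexity. *)
Lemma prox_obj_strongly_convex (R : realType) n (mu : R) (F : 'cV[R]_n -> R)
  c x y : (forall y, differentiable F y) -> weakly_convex mu F ->
  prox_obj mu F c y + dotp (grad (prox_obj mu F c) y) (x - y)
    + mu / 2 * dotp (x - y) (x - y) <= prox_obj mu F c x.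
Proof.
move=> dF wF; have := wF x y.
rewrite -[X in _ -> _ <= prox_obj _ _ _ X](subrKC y x) prox_obj_shift.
rewrite subrKC grad_prox_obj // /prox_obj !enorm_sq.
rewrite (dotpDl (grad F _)) dotpZl; lra.
Qed.

(** * One accelerated coordinate step *)

Lemma sampT_gt0 (R : realType) m (Lt : 'I_m -> R) :
  (0 < m)%N -> (forall i, 0 < Lt i) -> 0 < sampT Lt.
Proof.
case: m Lt => // m Lt _ Lt0; rewrite /sampT big_ord_recl.
by rewrite ltr_pwDl ?sqrtr_gt0 // sumr_ge0 // => i _; exact: sqrtr_ge0.
Qed.

Lemma sampp_gt0 (R : realType) m (Lt : 'I_m -> R) i :
  (forall i, 0 < Lt i) -> 0 < sampp Lt i.
Proof.
move=> Lt0; have m0 : (0 < m)%N by case: m i Lt Lt0 => [[]|].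
by rewrite divr_gt0 ?sqrtr_gt0 // sampT_gt0.
Qed.

Lemma sum_sampp (R : realType) m (Lt : 'I_m -> R) :
  (0 < m)%N -> (forall i, 0 < Lt i) -> \sum_i sampp Lt i = 1.
Proof.
by move=> m0 Lt0; rewrite -mulr_suml divff // lt0r_neq0 // sampT_gt0.
Qed.

Definition acd_rate (R : realType) m (Lt : 'I_m -> R) (mu : R) : R :=
  Num.sqrt mu / (Num.sqrt mu + sampT Lt).

Lemma acd_rate_itv (R : realType) m (Lt : 'I_m -> R) (mu : R) :
  (0 < m)%N -> (forall i, 0 < Lt i) -> 0 < mu -> 0 < acd_rate Lt mu < 1.
Proof.
move=> m0 Lt0 mu0; have T0 := sampT_gt0 m0 Lt0.
have r0 : 0 < Num.sqrt mu by rewrite sqrtr_gt0.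
rewrite /acd_rate divr_gt0 ?addr_gt0 //= ltr_pdivrMr ?addr_gt0 //.
by rewrite mul1r ltrDl.
Qed.

(** The potential of estimate-sequence arguments, with an arbitrary reference
    point u in place of the minimizer of q, so that near-minimizers serve. *)
Definition acd_potential (R : realType) n (mu : R) (q : 'cV[R]_n -> R)
  (u : 'cV[R]_n) (wz : 'cV[R]_n * 'cV[R]_n) : R :=
  q wz.1 - q u + mu / 2 * dotp (u - wz.2) (u - wz.2).

(** The three-point identity for z' compares with u, and the descent bound
    for the move from y to wbar produces the same inner product with z'. The
    quadratic remainder of the descent bound is absorbed by that of the
    identity, because the weights p_i proportional to sqrt (Lt i) make
    Lt i / p_i ^ 2 the same for all blocks. *)
Lemma acd_step_block (R : realType) m (d_ : 'I_m -> nat) opt (Lt : 'I_m -> R)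
  (mu : R) (q : 'cV[R]_(bdim d_) -> R) (u w z : 'cV[R]_(bdim d_)) (i : 'I_m)
  (y := (1 - acd_rate Lt mu) *: w + acd_rate Lt mu *: z) :
  0 < mu -> (forall i, 0 < Lt i) ->
  (forall i x s, q (x + Ublk R d_ i *m s) <=
     q x + dotp (blk i (grad q x)) s + Lt i / 2 * dotp s s) ->
  acd_potential mu q u (acd_step opt Lt mu q (w, z) i) <=
    q y - q u
    + acd_rate Lt mu / sampp Lt i * dotp (blk i (grad q y)) (blk i (u - z))
    + acd_rate Lt mu * mu / 2 * dotp (u - y) (u - y)
    + (1 - acd_rate Lt mu) * mu / 2 * dotp (u - z) (u - z).
Proof.
move=> mu0 Lt0 desc; have p0 := sampp_gt0 i Lt0.
have m0 : (0 < m)%N by case: m i {d_ q u w z y desc p0} Lt Lt0 => [[]|].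
have T0 := sampT_gt0 m0 Lt0; have /andP[a0 a1] := acd_rate_itv m0 Lt0 mu0.
rewrite /acd_step /= -/(acd_rate Lt mu) -/y.
set a := acd_rate Lt mu in a0 a1 y *; set p := sampp Lt i in p0 *.
set phi := fun x : 'cV[R]_(bdim d_) => _; set z' := argmin phi.
set k := a / p; have k0 : 0 < k by rewrite divr_gt0.
set r := Num.sqrt mu; have r0 : 0 < r by rewrite sqrtr_gt0.
have r2 : mu = r ^+ 2 by rewrite sqr_sqrtr // ltW.
set T := sampT Lt in T0 *.
have aE : a * (r + T) = r.
  by rewrite /a /acd_rate mulfVK // lt0r_neq0 // addr_gt0.
have kp : k * p = a by rewrite /k mulfVK // lt0r_neq0.
have LtE : Lt i = (p * T) ^+ 2.
  rewrite /p /sampp -/T mulfVK ?lt0r_neq0 // sqr_sqrtr //; exact: ltW.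
(* as Lt i / p ^ 2 = T ^ 2, this is a T <= r, the choice of the rate a *)
have LtT : Lt i * k ^+ 2 <= a * (r * T).
  have -> : Lt i * k ^+ 2 = a * (a * T * T) by rewrite LtE -kp; ring.
  rewrite ler_pM2l // ler_pM2r //; nra.
have three := @argmin_three_point _ _ phi (Ublk R d_ i *m blk i (grad q y)) y z
  (p * mu) (p * (r * T)).
have {}three := three _ _ u; rewrite -/z' in three.
set wbar := y + _.
have step : q wbar <= q y + k * dotp (blk i (grad q y)) (blk i z' - blk i z)
    + a * (r * T) / 2 * dotp (z' - z) (z' - z).
  rewrite /wbar scalemxAr; apply: le_trans (desc i y _) _.
  rewrite -addrA -[leRHS]addrA lerD2l !dotpZr lerD2l dotpZl.
  have B := dotp_blk_le i (z' - z); rewrite blkB in B.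
  have B0 := dotp_ge0 (blk i z' - blk i z).
  set b := dotp (blk i z' - _) _ in B B0 *; set Z := dotp (z' - z) _ in B *.
  have -> : Lt i / 2 * (k * (k * b)) = (Lt i * k ^+ 2) / 2 * b by field.
  have c0 := ltW (mulr_gt0 a0 (mulr_gt0 r0 T0)).
  by have := ler_wpM2r B0 LtT; have := ler_wpM2l c0 B; lra.
have opt_step : q (match opt with
    | OptionI => wbar + Ublk R d_ i *m (argmin (fun x : 'cV[R]_(d_ i) =>
          dotp (blk i (grad q wbar)) x + Lt i / 2 * enorm (x - blk i wbar) ^+ 2)
          - blk i wbar)
    | OptionII => wbar end) <= q wbar.
  case: opt => //; apply: le_trans (desc i wbar _) _.
  rewrite -addrA gerDl; exact: argmin_step_le0.
have phiE x : phi x = dotp (blk i (grad q y)) (blk i x)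
    + p * mu / 2 * dotp (x - y) (x - y)
    + p * (r * T) / 2 * dotp (x - z) (x - z) by rewrite /phi !enorm_sq.
have {}three : phi u = phi z' + (p * mu + p * (r * T)) / 2
      * dotp (u - z') (u - z').
  apply: three; last first.
    exact: addr_gt0 (mulr_gt0 p0 mu0) (mulr_gt0 p0 (mulr_gt0 r0 T0)).
  by move=> x; rewrite phiE dotp_Ublk.
have artE : a * (r * T) = (1 - a) * mu.
  have aT : a * T = r - a * r by rewrite -{1}aE; ring.
  by rewrite mulrCA aT r2; ring.
have armE : a * mu + a * (r * T) = mu by rewrite artE; ring.
have {}three : k * dotp (blk i (grad q y)) (blk i u)
    + a * mu / 2 * dotp (u - y) (u - y) + a * (r * T) / 2 * dotp (u - z) (u - z)
  = k * dotp (blk i (grad q y)) (blk i z')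
    + a * mu / 2 * dotp (z' - y) (z' - y)
    + a * (r * T) / 2 * dotp (z' - z) (z' - z)
    + mu / 2 * dotp (u - z') (u - z').
  rewrite -{3}armE -kp; move: three; rewrite !phiE
    => /(congr1 (fun d => k * d)).
  by move=> e; lra.
have yz : 0 <= a * mu / 2 * dotp (z' - y) (z' - y).
  by rewrite mulr_ge0 ?dotp_ge0 // divr_ge0 // (ltW (mulr_gt0 a0 mu0)).
rewrite /acd_potential /= -artE blkB !(dotpDr (blk i (grad q y))) !dotpNr.
move: step; rewrite (dotpDr (blk i (grad q y))) dotpNr => step.
lra.
Qed.

(** In the mean over i the factors 1 / p_i cancel and the block inner products
    add up to alpha <grad q y, u - z>. As alpha z = y - (1 - alpha) w, this is
    alpha <grad q y, u - y> + (1 - alpha) <grad q y, w - y>, which convexity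
    compares with q u and q w. *)
Lemma acd_step_contract (R : realType) m (d_ : 'I_m -> nat) opt
  (Lt : 'I_m -> R) (mu : R) (q : 'cV[R]_(bdim d_) -> R)
  (u : 'cV[R]_(bdim d_)) (wz : 'cV[R]_(bdim d_) * 'cV[R]_(bdim d_)) :
  (0 < m)%N -> 0 < mu -> (forall i, 0 < Lt i) ->
  (forall i x s, q (x + Ublk R d_ i *m s) <=
     q x + dotp (blk i (grad q x)) s + Lt i / 2 * dotp s s) ->
  (forall x y, q y + dotp (grad q y) (x - y)
                 + mu / 2 * dotp (x - y) (x - y) <= q x) ->
  \sum_i sampp Lt i * acd_potential mu q u (acd_step opt Lt mu q wz i) <=
    (1 - acd_rate Lt mu) * acd_potential mu q u wz.
Proof.
case: wz => w z m0 mu0 Lt0 desc sc.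
have /andP[a0 a1] := acd_rate_itv m0 Lt0 mu0.
have bound i := ler_wpM2l (ltW (sampp_gt0 i Lt0))
                  (acd_step_block opt u w z i mu0 Lt0 desc).
apply: le_trans (ler_sum _ (fun i _ => bound i)) _ => {bound}.
set a := acd_rate Lt mu in a0 a1 *; set y := (1 - a) *: w + a *: z.
set g := grad q y.
set A := a * mu / 2 * _; set B := _ * mu / 2 * _.
have -> : \sum_i sampp Lt i * (q y - q u
      + a / sampp Lt i * dotp (blk i g) (blk i (u - z)) + A + B)
    = q y - q u + a * dotp g (u - z) + A + B.
  rewrite -(sum_dotp_blk g) mulr_sumr.
  under eq_bigr => i _.
    have -> : sampp Lt i * (q y - q u
        + a / sampp Lt i * dotp (blk i g) (blk i (u - z)) + A + B)
      = sampp Lt i * (q y - q u + A + B) + a * dotp (blk i g) (blk i (u - z)).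
      by field; rewrite lt0r_neq0 // sampp_gt0.
    over.
  by rewrite big_split /= -mulr_suml (sum_sampp m0 Lt0); ring.
have -> : a * dotp g (u - z) = a * dotp g (u - y) + (1 - a) * dotp g (w - y).
  have -> : a * dotp g (u - z) = dotp g (a *: u - y + (1 - a) *: w).
    rewrite -dotpZr; congr dotp; apply/matrixP => i j; rewrite !mxE; ring.
  by rewrite !dotpE; ring.
have scu := ler_wpM2l (ltW a0) (sc u y).
have a1' : 0 <= 1 - a by rewrite subr_ge0 ltW.
have scw : (1 - a) * (q y + dotp g (w - y)) <= (1 - a) * q w.
  rewrite ler_wpM2l //; apply: le_trans (sc w y).
  by rewrite lerDl mulr_ge0 ?dotp_ge0 // divr_ge0 // ltW.
rewrite -/g in scu; rewrite /acd_potential /= /A /B; lra.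
Qed.

(** * Means over independent samples *)

Definition tuple_weight (R : realType) (I : finType) (w : I -> R) n
  (s : n.-tuple I) : R := \prod_(j < n) w (tnth s j).

Lemma sum_tuple0 (R : realType) (I : finType) (f : 0.-tuple I -> R) :
  \sum_s f s = f [tuple].
Proof.
by rewrite (big_pred1 [tuple]) // => s; apply/esym/eqP; rewrite [s]tuple0.
Qed.

Lemma sum_tuple_cons (R : realType) (I : finType) n
  (f : n.+1.-tuple I -> R) :
  \sum_s f s = \sum_(a : I) \sum_(s : n.-tuple I) f [tuple of a :: s].
Proof.
rewrite (pair_bigA _ (fun a (s : n.-tuple I) => f [tuple of a :: s])) /=.
rewrite (reindex (fun p : I * n.-tuple I => [tuple of p.1 :: p.2])) //=.
exists (fun s => (thead s, [tuple of behead s])) => [[a s]|s] _ /=.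
  by rewrite theadE; congr pair; exact: val_inj.
by rewrite -tuple_eta.
Qed.

Lemma tuple_weight_cons (R : realType) (I : finType) (w : I -> R) n a
  (s : n.-tuple I) :
  tuple_weight w [tuple of a :: s] = w a * tuple_weight w s.
Proof.
rewrite /tuple_weight big_ord_recl tnth0; congr (_ * _).
by apply: eq_bigr => j _; rewrite tnthS.
Qed.

Lemma tuple_weight_ge0 (R : realType) (I : finType) (w : I -> R) n
  (s : n.-tuple I) : (forall a, 0 <= w a) -> 0 <= tuple_weight w s.
Proof. by move=> w0; apply: prodr_ge0. Qed.

Lemma sum_tuple_weight (R : realType) (I : finType) (w : I -> R) n :
  \sum_a w a = 1 -> \sum_(s : n.-tuple I) tuple_weight w s = 1.
Proof.
move=> w1; elim: n => [|n IH].
  rewrite sum_tuple0.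
  by rewrite /tuple_weight big_ord0.
rewrite sum_tuple_cons -w1; apply: eq_bigr => a _.
under eq_bigr => s _ do rewrite tuple_weight_cons.
by rewrite -mulr_sumr IH mulr1.
Qed.

(** The shape of linear convergence in mean: a Markov property makes a one-step
    mean contraction from every state multiply along the trajectory. *)
Lemma mean_foldl_contract (R : realType) (I : finType) (w : I -> R) (X : Type)
  (step : X -> I -> X) (V : X -> R) (rho : R) n x :
  (forall a, 0 <= w a) -> 0 <= rho ->
  (forall x, \sum_a w a * V (step x a) <= rho * V x) ->
  \sum_(s : n.-tuple I) tuple_weight w s * V (foldl step x s) <= rho ^+ n * V x.
Proof.
move=> w0 rho0 hV; elim: n x => [|n IH] x.
  rewrite sum_tuple0.
  by rewrite /tuple_weight big_ord0 expr0.
rewrite sum_tuple_cons exprSr -mulrA.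
apply: le_trans (ler_wpM2l (exprn_ge0 n rho0) (hV x)).
rewrite mulr_sumr; apply: ler_sum => a _ /=.
under eq_bigr => s _ do rewrite tuple_weight_cons -mulrA.
by rewrite -mulr_sumr mulrCA ler_wpM2l.
Qed.

(** A potential that drops in mean by at least the cost of each new state pays
    for the mean total cost of the trajectory. *)
Lemma mean_foldl_telescope (R : realType) (I : finType) (w : I -> R)
  (X : Type) (step : X -> I -> X) (G V : X -> R) n x :
  (forall a, 0 <= w a) -> \sum_a w a = 1 ->
  (forall x, \sum_a w a * (G (step x a) + V (step x a)) <= V x) ->
  \sum_(s : n.-tuple I) tuple_weight w s *
     (\sum_(l < n) G (foldl step x (take l.+1 s)) + V (foldl step x s)) <= V x.
Proof.
move=> w0 w1 hV; elim: n x => [|n IH] x.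
  rewrite sum_tuple0.
  by rewrite /tuple_weight !big_ord0 mul1r add0r.
rewrite sum_tuple_cons; apply: le_trans (hV x); apply: ler_sum => a _ /=.
under eq_bigr => s _.
  rewrite tuple_weight_cons big_ord_recl /= take0 /= -!addrA mulrDr -mulrA.
  rewrite -(mulrA (w a)).
  over.
rewrite big_split /= -!mulr_sumr -mulrDr ler_wpM2l // lerD //.
by rewrite -mulr_suml sum_tuple_weight // mul1r.
Qed.

(** * Linear convergence of a run of accelerated coordinate descent *)

(** Strong convexity at the midpoint of u and w. *)
Lemma strongly_convex_dist (R : realType) n (mu : R) (q : 'cV[R]_n -> R)
  (lb : R) (u w : 'cV[R]_n) :
  (forall x y, q y + dotp (grad q y) (x - y)
                 + mu / 2 * dotp (x - y) (x - y) <= q x) ->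
  (forall x, lb <= q x) ->
  mu / 4 * dotp (u - w) (u - w) <= (q w - lb) + (q u - lb).
Proof.
move=> sc hlb; set c := 2^-1 *: (u + w).
have := sc u c; have := sc w c; have := hlb c.
have -> : u - c = 2^-1 *: (u - w).
  by apply/matrixP => i j; rewrite !mxE; field.
have -> : w - c = - (2^-1 *: (u - w)).
  by apply/matrixP => i j; rewrite !mxE; field.
rewrite !(dotpNr, dotpNl) !(dotpZr, dotpZl); lra.
Qed.

(** One gradient step cannot go below the lower bound lb. *)
Lemma sq_grad_le_gap (R : realType) n (L : R) (q : 'cV[R]_n -> R) (lb : R) x :
  0 < L ->
  (forall x v, q (x + v) <= q x + dotp (grad q x) v + L / 2 * dotp v v) ->
  (forall x, lb <= q x) ->
  dotp (grad q x) (grad q x) <= 2 * L * (q x - lb).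
Proof.
move=> L0 desc hlb.
have := le_trans (hlb _) (desc x (- (L^-1 *: grad q x))).
rewrite !(dotpNr, dotpNl) !(dotpZr, dotpZl) opprK.
set D := dotp _ _ => h.
have -> : D = L * (L^-1 * D) by rewrite mulVKf // lt0r_neq0.
have e : L / 2 * (L^-1 * (L^-1 * D)) = L^-1 * D / 2.
  by field; rewrite lt0r_neq0.
rewrite e in h.
rewrite [2 * L]mulrC -mulrA ler_pM2l //; lra.
Qed.

(** For the reference point u of the potential, q u tends to the infimum lb; by
    strong convexity the distance term of the initial potential costs twice
    the initial gap. *)
Lemma mean_acd_gap (R : realType) m (d_ : 'I_m -> nat) opt
  (Lt : 'I_m -> R) (mu : R) (q : 'cV[R]_(bdim d_) -> R) (lb : R) t
  (w0 : 'cV[R]_(bdim d_)) :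
  (0 < m)%N -> 0 < mu -> (forall i, 0 < Lt i) ->
  (forall i x s, q (x + Ublk R d_ i *m s) <=
     q x + dotp (blk i (grad q x)) s + Lt i / 2 * dotp s s) ->
  (forall x y, q y + dotp (grad q y) (x - y)
                 + mu / 2 * dotp (x - y) (x - y) <= q x) ->
  (forall x, lb <= q x) -> (forall e, 0 < e -> exists u, q u < lb + e) ->
  \sum_(s : t.-tuple 'I_m) tuple_weight (sampp Lt) s *
     (q (acd opt Lt mu q w0 s) - lb)
  <= 3 * (1 - acd_rate Lt mu) ^+ t * (q w0 - lb).
Proof.
move=> m0 mu0 Lt0 desc sc hlb hinf.
have /andP[a0 a1] := acd_rate_itv m0 Lt0 mu0.
set rho := 1 - acd_rate Lt mu.
have rho0 : 0 <= rho by rewrite subr_ge0 ltW.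
have rho1 : rho <= 1 by rewrite gerBl ltW.
have rt0 : 0 <= rho ^+ t by rewrite exprn_ge0.
have rt1 : rho ^+ t <= 1 by rewrite exprn_ile1.
apply/ler_addgt0Pr => e e0; have e30 : 0 < e / 3 by rewrite divr_gt0.
have [u hu] := hinf _ e30.
have p0 i : 0 <= sampp Lt i by exact: ltW (sampp_gt0 i Lt0).
have := @mean_foldl_contract _ _ (sampp Lt) _ (acd_step opt Lt mu q)
  (acd_potential mu q u) rho t (w0, w0) p0 rho0
  (fun wz => acd_step_contract opt u wz m0 mu0 Lt0 desc sc).
rewrite {2}/acd_potential /= => contract.
have W1 := sum_tuple_weight t (sum_sampp m0 Lt0).
have low : \sum_(s : t.-tuple 'I_m) tuple_weight (sampp Lt) s *
     (q (acd opt Lt mu q w0 s) - lb) <=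
   \sum_(s : t.-tuple 'I_m) tuple_weight (sampp Lt) s *
      acd_potential mu q u (foldl (acd_step opt Lt mu q) (w0, w0) s)
    + (q u - lb).
  rewrite -[X in _ + X]mul1r -W1 mulr_suml -big_split /=; apply: ler_sum => s _.
  rewrite -mulrDr ler_wpM2l ?tuple_weight_ge0 // /acd /acd_potential.
  set x := foldl _ _ _; have := dotp_ge0 (u - x.2).
  by move=> /(mulr_ge0 (divr_ge0 (ltW mu0) (ler0n R 2))); lra.
have dist := strongly_convex_dist u w0 sc hlb.
have hw := hlb w0; have hu' := hlb u.
set E := \sum_(s : _) _ in contract low *.
have : rho ^+ t * (q w0 - q u + mu / 2 * dotp (u - w0) (u - w0)) <=
       rho ^+ t * (3 * (q w0 - lb) + 2 * (q u - lb)).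
  by rewrite ler_wpM2l //; lra.
have : rho ^+ t * (q u - lb) <= q u - lb.
  by rewrite ler_piMl // subr_ge0.
lra.
Qed.

(** * One outer iteration *)

Lemma prox_obj_lb (R : realType) n (mu Fmin : R) (F : 'cV[R]_n -> R) c x :
  0 < mu -> (forall x, Fmin <= F x) -> Fmin <= prox_obj mu F c x.
Proof.
move=> mu0 h; apply: le_trans (h x) _.
by rewrite lerDl mulr_ge0 ?sqr_ge0 // ltW.
Qed.

Definition prox_inf (R : realType) n (mu : R) (F : 'cV[R]_n -> R) c : R :=
  inf (range (prox_obj mu F c)).

Lemma prox_inf_le (R : realType) n (mu Fmin : R) (F : 'cV[R]_n -> R) c x :
  0 < mu -> (forall x, Fmin <= F x) -> prox_inf mu F c <= prox_obj mu F c x.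
Proof.
move=> mu0 h; apply: ge_inf; last by exists x.
by exists Fmin => _ [y _ <-]; exact: prox_obj_lb.
Qed.

Lemma prox_inf_approx (R : realType) n (mu Fmin : R) (F : 'cV[R]_n -> R) c e :
  0 < mu -> (forall x, Fmin <= F x) -> 0 < e ->
  exists u, prox_obj mu F c u < prox_inf mu F c + e.
Proof.
move=> mu0 h e0.
have hi : has_inf (range (prox_obj mu F c)).
  split; first by exists (prox_obj mu F c c); exists c.
  by exists Fmin => _ [y _ <-]; exact: prox_obj_lb.
by have [_ [u _ <-] ?] := inf_adherent e0 hi; exists u.
Qed.

Lemma prox_obj_center (R : realType) n (mu : R) (F : 'cV[R]_n -> R) c :
  prox_obj mu F c c = F c.
Proof. by rewrite /prox_obj subrr enorm_sq dotp0l mulr0 addr0. Qed.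

Definition acpp_step (R : realType) m (d_ : 'I_m -> nat) opt (L_ : 'I_m -> R)
  (mu : R) (F : 'cV[R]_(bdim d_) -> R) t (c : 'cV[R]_(bdim d_))
  (s : t.-tuple 'I_m) : 'cV[R]_(bdim d_) :=
  acd opt (acpp_Lt L_ mu) mu (prox_obj mu F c) c s.

Definition run_weight (R : realType) m (L_ : 'I_m -> R) (mu : R) t :
  t.-tuple 'I_m -> R := fun s => tuple_weight (sampp (acpp_Lt L_ mu)) s.

Section OuterIteration.

Context (R : realType) (m : nat) (d_ : 'I_m -> nat) (opt : acd_option)
  (L_ : 'I_m -> R) (L mu : R) (F : 'cV[R]_(bdim d_) -> R)
  (xstar : 'cV[R]_(bdim d_)) (t : nat).
Hypotheses (m0 : (0 < m)%N) (mu0 : 0 < mu) (L0 : 0 < L) (muL : mu <= L)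
  (L_0 : forall i, 0 < L_ i) (dF : forall x, differentiable F x)
  (bF : block_smooth L_ F) (sF : smooth L F) (wF : weakly_convex mu F)
  (Fmin : forall x, F xstar <= F x).

Let Lt := acpp_Lt L_ mu.
Let delta := mu / (L + 2 * mu).

Hypothesis t_large : 3 * (1 - acd_rate Lt mu) ^+ t <= delta.

Let q c := prox_obj mu F c.
Let step := acpp_step opt L_ mu F (t := t).
Let W := @run_weight R m L_ mu t.

Let Lt0 i : 0 < Lt i.
Proof. by rewrite addr_gt0 // mulr_gt0. Qed.

Lemma run_weight_ge0 s : 0 <= W s.
Proof. by apply: tuple_weight_ge0 => i; exact: ltW (sampp_gt0 i Lt0). Qed.

Lemma sum_run_weight : \sum_s W s = 1.
Proof. exact: sum_tuple_weight (sum_sampp m0 Lt0). Qed.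

Let delta0 : 0 < delta.
Proof. by rewrite divr_gt0 // addr_gt0 // mulr_gt0. Qed.

Let deltaE : delta * (L + 2 * mu) = mu.
Proof. by rewrite mulfVK // lt0r_neq0 // addr_gt0 // mulr_gt0. Qed.

Let delta_le : delta <= 3^-1.
Proof.
rewrite /delta ler_pdivrMr ?addr_gt0 ?mulr_gt0 //; move: muL; lra.
Qed.

Lemma mean_prox_gap c :
  \sum_s W s * (q c (step c s) - prox_inf mu F c)
  <= delta * (F c - prox_inf mu F c).
Proof.
apply: le_trans (mean_acd_gap opt t c m0 mu0 Lt0 _ _ _ _) _.
- by move=> i x s; exact: prox_obj_block_descent.
- by move=> x y; exact: prox_obj_strongly_convex.
- by move=> x; exact: prox_inf_le mu0 Fmin.
- by move=> e; exact: prox_inf_approx mu0 Fmin.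
rewrite prox_obj_center ler_wpM2r // subr_ge0 -(prox_obj_center mu F c).
exact: prox_inf_le mu0 Fmin.
Qed.

Lemma mean_affine_gap c (A B : R) : 0 <= A ->
  \sum_s W s * (A * (q c (step c s) - prox_inf mu F c) + B)
  <= A * (delta * (F c - prox_inf mu F c)) + B.
Proof.
move=> A0.
have -> : \sum_s W s * (A * (q c (step c s) - prox_inf mu F c) + B)
  = A * (\sum_s W s * (q c (step c s) - prox_inf mu F c)) + B.
  rewrite -[X in _ = _ + X]mul1r -sum_run_weight mulr_suml mulr_sumr.
  rewrite -big_split; apply: eq_bigr => s _ /=; ring.
by rewrite lerD2r ler_wpM2l // mean_prox_gap.
Qed.

(** The inequality |g - h|^2 <= 2 |g|^2 + 2 |h|^2 with h = 2 mu (x - c), the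
    gradient of the proximal term. *)
Lemma sq_grad_le_prox_grad c x :
  dotp (grad F x) (grad F x) <= 2 * dotp (grad (q c) x) (grad (q c) x)
    + 8 * mu * (q c x - F x).
Proof.
have -> : grad F x = grad (q c) x - (2 * mu) *: (x - c).
  by rewrite grad_prox_obj // addrK.
have -> : q c x - F x = mu * dotp (x - c) (x - c).
  by rewrite /q /prox_obj enorm_sq addrAC subrr add0r.
have := dotp_ge0 (grad (q c) x + (2 * mu) *: (x - c)).
set g := grad (q c) x; set h := x - c.
rewrite dotp_sqD (dotp_sqD g) !(dotpNr, dotpNl) !(dotpZr, dotpZl); lra.
Qed.

(** The squared gradient and the objective at the new iterate are both
    controlled by the proximal gap, up to 8 mu times the proximal infimum; the
    choice of delta makes the gap cost at most what the objective loses. *)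
Lemma mean_outer_decrease c :
  \sum_s W s * (enorm (grad F (step c s)) ^+ 2
                + 8 * mu * (F (step c s) - F xstar))
  <= 8 * mu * (F c - F xstar).
Proof.
set l := prox_inf mu F c.
have A0 : 0 <= 4 * (L + 2 * mu) + 8 * mu by move: mu0 L0; lra.
apply: (@le_trans _ _ (\sum_s W s * ((4 * (L + 2 * mu) + 8 * mu)
      * (q c (step c s) - l) + 8 * mu * (l - F xstar)))).
  apply: ler_sum => s _; rewrite ler_wpM2l ?run_weight_ge0 // enorm_sq.
  set x := step c s; have h := sq_grad_le_prox_grad c x.
  have L20 : 0 < L + 2 * mu by move: mu0 L0; lra.
  have := @sq_grad_le_gap _ _ (L + 2 * mu) (q c) l x L20
    (fun x v => prox_obj_descent mu c x v L0 dF sF)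
    (fun x => prox_inf_le c x mu0 Fmin).
  lra.
apply: le_trans (mean_affine_gap _ _ A0) _; rewrite -/l.
have lc : 0 <= F c - l.
  by rewrite subr_ge0 -(prox_obj_center mu F c); exact: prox_inf_le mu0 Fmin.
have -> : (4 * (L + 2 * mu) + 8 * mu) * (delta * (F c - l))
  = 4 * mu * (F c - l) + 8 * mu * (delta * (F c - l)).
  by rewrite -{3}deltaE; ring.
have : mu * (delta * (F c - l)) <= mu * (3^-1 * (F c - l)).
  by rewrite ler_pM2l // ler_wpM2r.
have := mulr_ge0 (ltW mu0) lc; lra.
Qed.

Lemma grad_xstar : grad F xstar = 0.
Proof.
apply: dotp_eq0.
have := @sq_grad_le_gap _ _ L F (F xstar) xstar L0
  (fun x v => smooth_descent x v L0 dF sF) Fmin.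
by rewrite subrr mulr0.
Qed.

(** The gap at x^1 no longer involves L: the proximal infimum is at most
    F xstar + mu ||x0 - xstar||^2, and the initial gap, at most
    L / 2 ||x0 - xstar||^2, is multiplied by delta. *)
Lemma mean_first_gap x0 :
  \sum_s W s * (F (step x0 s) - F xstar) <=
  2 * mu * enorm (x0 - xstar) ^+ 2.
Proof.
set l := prox_inf mu F x0.
apply: (@le_trans _ _ (\sum_s W s * (1 * (q x0 (step x0 s) - l)
                                     + (l - F xstar)))).
  apply: ler_sum => s _; rewrite ler_wpM2l ?run_weight_ge0 //.
  have := mulr_ge0 (ltW mu0) (sqr_ge0 (enorm (step x0 s - x0))).
  rewrite /q /prox_obj; lra.
apply: le_trans (mean_affine_gap _ _ ler01) _; rewrite -/l mul1r.
set D := enorm _ ^+ 2.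
have l_le : l <= F xstar + mu * D.
  have := prox_inf_le x0 xstar mu0 Fmin; rewrite -/l /prox_obj /D !enorm_sq.
  by rewrite -(opprB x0) dotpNl dotpNr opprK.
have F0 : F x0 - F xstar <= L / 2 * D.
  have := smooth_descent xstar (x0 - xstar) L0 dF sF.
  by rewrite subrKC grad_xstar dotp0l addr0 /D enorm_sq; lra.
have D0 : 0 <= D by exact: sqr_ge0.
have e1 : delta * (F x0 - F xstar) <= mu * D / 2.
  apply: le_trans (ler_wpM2l (ltW delta0) F0) _.
  have -> : delta * (L / 2 * D) = (delta * L) * (D / 2) by ring.
  rewrite -[leRHS]mulrA ler_wpM2r ?divr_ge0 // -deltaE.
  by rewrite ler_pM2l // lerDl mulr_ge0 // ltW.
have e2 : (1 - delta) * (l - F xstar) <= (1 - delta) * (mu * D).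
  by rewrite ler_wpM2l //; move: delta_le; lra.
have e3 := mulr_ge0 (ltW mu0) D0; have e4 := mulr_ge0 (ltW delta0) e3.
lra.
Qed.

End OuterIteration.

(** * The whole run *)

(** Conditioning on the first outer iteration, then telescoping over the
    remaining K ones. *)
Lemma mean_run_sq_grad (R : realType) m (d_ : 'I_m -> nat) opt
  (L_ : 'I_m -> R) (L mu : R) (F : 'cV[R]_(bdim d_) -> R)
  (x0 xstar : 'cV[R]_(bdim d_)) t K :
  (0 < m)%N -> (0 < K)%N -> 0 < mu -> 0 < L -> mu <= L ->
  (forall i, 0 < L_ i) -> (forall x, differentiable F x) ->
  block_smooth L_ F -> smooth L F -> weakly_convex mu F ->
  (forall x, F xstar <= F x) ->
  3 * (1 - acd_rate (acpp_Lt L_ mu) mu) ^+ t <= mu / (L + 2 * mu) ->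
  acpp_expectation (acpp_Lt L_ mu)
    (fun om : acpp_outcome m t K =>
       enorm (grad F (acpp_output opt L_ mu F x0 om)) ^+ 2)
  <= 16 * mu ^+ 2 * enorm (x0 - xstar) ^+ 2 / K%:R.
Proof.
move=> m0 K0 mu0 L0 muL L_0 dF bF sF wF Fmin ht.
set w := run_weight L_ mu (t := t).
have w0 s : 0 <= w s by exact: run_weight_ge0.
have w1 : \sum_s w s = 1 by exact: sum_run_weight.
pose G x := enorm (grad F x) ^+ 2.
pose V x := 8 * mu * (F x - F xstar).
pose step := acpp_step opt L_ mu F (t := t).
have V0 x : 0 <= V x by rewrite mulr_ge0 ?subr_ge0 // mulr_ge0 // ltW.
have -> : acpp_expectation (acpp_Lt L_ mu)
    (fun om : acpp_outcome m t K =>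
       enorm (grad F (acpp_output opt L_ mu F x0 om)) ^+ 2) =
  (\sum_(s : K.+1.-tuple (t.-tuple 'I_m)) tuple_weight w s *
     \sum_(l < K) G (foldl step x0 (take (l + 2) s))) / K%:R.
  rewrite /acpp_expectation -(pair_bigA _ (fun s l => acpp_prob (acpp_Lt L_ mu)
    (s, l) * enorm (grad F (acpp_output opt L_ mu F x0 (s, l))) ^+ 2)) /=.
  rewrite mulr_suml; apply: eq_bigr => s _.
  by rewrite mulrAC mulr_sumr; apply: eq_bigr => l _; congr (_ * _).
rewrite ler_pM2r ?invr_gt0 ?ltr0n // sum_tuple_cons.
have first := mean_first_gap opt m0 mu0 L0 muL L_0 dF bF sF wF Fmin ht x0.
apply: (@le_trans _ _ (\sum_a w a * V (step x0 a))).
  apply: ler_sum => a _.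
  under eq_bigr => s _ do rewrite tuple_weight_cons -mulrA.
  rewrite -mulr_sumr ler_wpM2l //.
  apply: le_trans (@mean_foldl_telescope _ _ w _ step G V K (step x0 a)
                         w0 w1 _).
    apply: ler_sum => s _; rewrite ler_wpM2l ?tuple_weight_ge0 //.
    apply: (@le_trans _ _ (\sum_(l < K) G (foldl step (step x0 a)
                                             (take l.+1 s)))); last first.
      by rewrite lerDl.
    by apply: ler_sum => l _; rewrite addn2.
  by move=> x; exact: (mean_outer_decrease opt m0 mu0 L0 muL L_0 dF bF
                             sF wF Fmin ht x).
have -> : \sum_a w a * V (step x0 a)
  = 8 * mu * \sum_a w a * (F (step x0 a) - F xstar).
  by rewrite mulr_sumr; apply: eq_bigr => a _; rewrite /V mulrCA.
have mu8 : 0 <= 8 * mu by rewrite mulr_ge0 // ltW.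
apply: le_trans (ler_wpM2l mu8 first) _.
rewrite le_eqVlt; apply/orP; left; apply/eqP; ring.
Qed.

(** * Choice of the numbers of iterations *)

Lemma nat_above (R : realType) (x : R) : 0 <= x ->
  exists n : nat, x <= n%:R <= x + 1.
Proof.
move=> x0; exists (Num.truncn x).+1.
have /andP[h1 h2] := truncn_itv x0.
by rewrite ltW //= -natr1 lerD2r.
Qed.

Lemma one_sub_exp_le (R : realType) (a e : R) (t : nat) :
  0 < a < 1 -> 0 < e -> ln e^-1 <= a * t%:R -> (1 - a) ^+ t <= e.
Proof.
move=> /andP[a0 a1] e0 h.
apply: (@le_trans _ _ (expR (- (a * t%:R)))).
  rewrite -mulNr mulrC expRM_natl.
  apply: lerXn2r; rewrite ?nnegrE ?subr_ge0 ?expR_ge0 // ?(ltW a1) //.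
  exact: expR_ge1Dx.
rewrite -[leRHS]lnK // ler_expR; move: h; rewrite lnV //; lra.
Qed.

(** The hypothesis kappa mu <= L, L_i turns the constants and the roundings
    up into multiples of the leading terms. *)
Lemma iteration_budget (R : realType) (kappa : R) (hkappa : 1 < kappa)
  m (L_ : 'I_m -> R) (L mu : R) :
  (0 < m)%N -> 0 < mu -> (forall i, kappa * mu <= L_ i) -> kappa * mu <= L ->
  exists2 t : nat,
    3 * (1 - acd_rate (acpp_Lt L_ mu) mu) ^+ t <= mu / (L + 2 * mu) &
    t%:R <= (3 * (1 + ln 9 / ln kappa) + (ln kappa)^-1) *
      ((\sum_(i < m) Num.sqrt (L_ i)) / Num.sqrt mu * ln (L / mu)).
Proof.
move=> m0 mu0 hL_ hL.
have muk : mu <= kappa * mu by rewrite ler_peMl // ltW.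
have muL_ i : mu <= L_ i := le_trans muk (hL_ i).
have muL : mu <= L := le_trans muk hL.
have L0 : 0 < L := lt_le_trans mu0 muL.
set r := Num.sqrt mu; have r0 : 0 < r by rewrite sqrtr_gt0.
set S := \sum_(i < m) _; set T := sampT (acpp_Lt L_ mu).
have S_ge : r <= S.
  case: m L_ hL_ muL_ m0 @S {T} => // m L_ _ muL_ _.
  rewrite big_ord_recl /r; apply: ler_wpDr; last by rewrite ler_wsqrtr.
  by apply: sumr_ge0 => i _; exact: sqrtr_ge0.
have T_le : T <= 2 * S.
  rewrite /T /sampT mulr_sumr; apply: ler_sum => i _.
  have Li0 : 0 <= L_ i := le_trans (ltW mu0) (muL_ i).
  have -> : 2 * Num.sqrt (L_ i) = Num.sqrt (2 ^+ 2 * L_ i).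
    by rewrite sqrtrM ?sqr_ge0 // sqrtr_sqr ger0_norm.
  by rewrite ler_wsqrtr // /acpp_Lt; have := muL_ i; lra.
have Lt0 i : 0 < acpp_Lt L_ mu i by rewrite /acpp_Lt; have := muL_ i; lra.
have T0 := sampT_gt0 m0 Lt0; rewrite -/T in T0.
have /andP[a0 a1] := acd_rate_itv m0 Lt0 mu0.
set a := acd_rate _ _ in a0 a1 *.
have aV : a^-1 <= 3 * (S / r).
  rewrite /a /acd_rate -/T -/r invf_div ler_pdivrMr // -mulrA.
  rewrite mulfVK ?lt0r_neq0 //; lra.
have lk0 : 0 < ln kappa by rewrite ln_gt0.
set l := ln (L / mu).
have l_ge : ln kappa <= l.
  have k0 : 0 < kappa := lt_trans ltr01 hkappa.
  by rewrite ler_ln ?posrE ?divr_gt0 // ler_pdivlMr.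
have l0 : 0 < l := lt_le_trans lk0 l_ge.
have l9 : 0 <= ln 9 :> R by rewrite ln_ge0 // ler1n.
have l9_le : ln 9 + l <= (1 + ln 9 / ln kappa) * l.
  rewrite mulrDl mul1r addrC lerD2l mulrAC ler_pdivlMr //.
  by rewrite ler_wpM2l.
have arg0 : 0 <= a^-1 * (ln 9 + l).
  by rewrite mulr_ge0 ?invr_ge0 ?addr_ge0 // ltW.
have [t /andP[t_ge t_le]] := nat_above arg0.
exists t.
  (* the target ratio is 3 (L + 2 mu) / mu, at most 9 L / mu *)
  have e0 : 0 < mu / (3 * (L + 2 * mu)) by rewrite divr_gt0 //; lra.
  have -> : mu / (L + 2 * mu) = 3 * (mu / (3 * (L + 2 * mu))).
    field; apply: lt0r_neq0; lra.
  rewrite ler_pM2l //; apply: one_sub_exp_le e0 _; first by rewrite a0.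
  rewrite invf_div; apply: (@le_trans _ _ (ln 9 + l)).
    have P1 : 0 < 3 * (L + 2 * mu) / mu by rewrite divr_gt0 //; lra.
    have P2 : 0 < L / mu by rewrite divr_gt0.
    rewrite /l -lnM ?posrE // ler_ln ?posrE ?(mulr_gt0 _ P2) //.
    by rewrite mulrA ler_pM2r ?invr_gt0 //; lra.
  by rewrite mulrC -ler_pdivrMr // mulrC.
apply: le_trans t_le _.
have Sr1 : 1 <= S / r by rewrite ler_pdivlMr // mul1r.
have Sr0 : 0 <= S / r := le_trans ler01 Sr1.
rewrite mulrDl lerD //.
  have -> : 3 * (1 + ln 9 / ln kappa) * (S / r * l)
    = (3 * (S / r)) * ((1 + ln 9 / ln kappa) * l) by ring.
  by apply: ler_pM => //; rewrite ?invr_ge0 ?addr_ge0 // ltW.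
rewrite mulrC ler_pdivlMr // mul1r.
by apply: le_trans l_ge _; rewrite ler_peMl // ltW.
Qed.

Theorem corollary14 (R : realType) (kappa : R) (hkappa : 1 < kappa) :
  exists C : R, 0 < C /\
  forall (m : nat) (d_ : 'I_m -> nat) (L_ : 'I_m -> R) (L mu : R),
    (0 < m)%N -> 0 < mu -> 0 < L -> (forall i, 0 < L_ i) ->
    (forall i, kappa * mu <= L_ i) -> kappa * mu <= L ->
  forall (x0 xstar : 'cV[R]_(bdim d_)) (eps : R),
    0 < eps -> (x0 <> xstar -> eps <= mu ^+ 2 * enorm (x0 - xstar) ^+ 2) ->
  exists t K : nat,
    [/\ (0 < K)%N,
        (t * K.+1)%:R <=
          C * ((\sum_(i < m) Num.sqrt (L_ i)) * Num.sqrt mu * ln (L / mu)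
               * (mu * enorm (x0 - xstar) ^+ 2 / eps))
      & forall (opt : acd_option) (F : 'cV[R]_(bdim d_) -> R),
          continuously_differentiable F ->
          block_smooth L_ F -> smooth L F ->
          weakly_convex mu F -> bounded_level_sets F ->
          (forall x, F xstar <= F x) ->
          acpp_expectation (acpp_Lt L_ mu)
            (fun om : acpp_outcome m t K =>
               enorm (grad F (acpp_output opt L_ mu F x0 om)) ^+ 2) <= eps ].
Proof.
have lk0 : 0 < ln kappa by rewrite ln_gt0.
set C1 := 3 * (1 + ln 9 / ln kappa) + (ln kappa)^-1.
have l9 : 0 <= ln 9 :> R by rewrite ln_ge0 // ler1n.
have C10 : 0 < C1.
  have := divr_ge0 l9 (ltW lk0); have : 0 < (ln kappa)^-1 by rewrite invr_gt0.
  rewrite /C1; lra.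
(* K + 1 <= 16 M + 2 <= 18 M for M = mu ^ 2 ||x0 - xstar||^2 / eps >= 1 *)
exists (18 * C1); split; first by rewrite mulr_gt0.
move=> m d_ L_ L mu m0 mu0 L0 L_0 hL_ hL x0 xstar eps eps0 heps.
have [x0E|/eqP/heps eps_le] := eqVneq x0 xstar.
  exists 0%N, 1%N; split=> //.
    by rewrite mul0n x0E subrr enorm_sq dotp0l mulr0 mul0r !mulr0.
  move=> opt F [dF _] _ sF _ _ Fmin.
  rewrite /acpp_expectation big1 ?ltW // => om _.
  have -> : acpp_output opt L_ mu F x0 om = xstar.
    rewrite /acpp_output /acpp_iter -x0E; elim: (take _ _) => //= s l IH.
    by rewrite [s]tuple0.
  by rewrite (grad_xstar L0 dF sF Fmin) enorm_sq dotp0l mulr0.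
set M := mu ^+ 2 * enorm (x0 - xstar) ^+ 2 / eps.
have M1 : 1 <= M by rewrite ler_pdivlMr // mul1r.
have M16 : 0 <= 16 * M by lra.
have [K /andP[K_ge K_le]] := nat_above M16.
have K0 : (0 < K)%N by rewrite -(ltr_nat R); lra.
have [t ht t_le] := iteration_budget hkappa m0 mu0 hL_ hL.
exists t, K; split=> //.
  rewrite natrM -(natr1 K).
  set S := \sum_(i < m) _ in t_le *; set l := ln (L / mu) in t_le *.
  have -> : 18 * C1 * (S * Num.sqrt mu * l
      * (mu * enorm (x0 - xstar) ^+ 2 / eps))
    = C1 * (S / Num.sqrt mu * l) * (18 * M).
    have -> : S / Num.sqrt mu = S * Num.sqrt mu / mu.
      rewrite -{3}(sqr_sqrtr (ltW mu0)); field.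
      by rewrite lt0r_neq0 // sqrtr_gt0.
    by rewrite /M; field; rewrite !lt0r_neq0.
  by apply: ler_pM => //; lra.
move=> opt F [dF _] bF sF wF _ Fmin.
have muL : mu <= L by apply: le_trans hL; rewrite ler_peMl // ltW.
apply: le_trans (mean_run_sq_grad opt x0 m0 K0 mu0 L0 muL L_0 dF bF sF wF
                                  Fmin ht) _.
rewrite ler_pdivrMr ?ltr0n //.
have -> : 16 * mu ^+ 2 * enorm (x0 - xstar) ^+ 2 = eps * (16 * M).
  by rewrite /M; field; rewrite lt0r_neq0.
by rewrite ler_pM2l.
Qed.
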